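(* Let $d\ge 2$, let $R=\mathbb{C}[x,y,z]$ with its standard grading, and let $R_1$ be its space of linear forms. Let $J=\langle F_1,F_2,F_3\rangle\in\mathbb{H}^{d^2+d+1}(\mathbb{P}^2)$, where $F_1,F_2,F_3\in R$ are homogeneous polynomials of degree $d+1$ that are linearly independent and without common factors, and assume that $J$ contains no nonzero polynomials of degree $\le d$. Let $M=R/J$ and let $$0\to R(-b_1)\oplus R(-b_2)\xrightarrow{\ \varphi_2\ } R(-d-1)^3\xrightarrow{\ \varphi_1\ } R\xrightarrow{\ \varphi_0\ } M$$ be its minimal graded free resolution, where $\varphi_0$ is the quotient map, $\varphi_1=\begin{pmatrix}F_1&F_2&F_3\end{pmatrix}$, $\varphi_2=(m_{ij})$ is a $3\times 2$ matrix whose nonzero entries are homogeneous polynomials of degree $b_j-d-1$ (for entries in column $j$), and $b_1\ge b_2\ge d+1$. Then there is a column $\Lambda$ in the presentation $\varphi_2$ whose entries generate a $2$-dimensional or $3$-dimensional $\mathbb{C}$-vector space $W$ in $R_1$ if, and only if, $b_2=d+2$. In particular, the polynomials $F_1,F_2,F_3$ satisfy Euler's condition if, and only if, the vector space $W$ is $3$-dimensional.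
   Context: $\mathbb{H}^{N}(\mathbb{P}^2)$ denotes the Hilbert scheme of $N$ points in $\mathbb{P}^2$, i.e. the set of all saturated homogeneous zero-dimensional ideals of $\mathbb{C}[x,y,z]$ with Hilbert polynomial equal to the constant $N$. Under the stated assumptions on $J$, the minimal graded free resolution of $R/J$ has the displayed form (by the Hilbert–Burch theorem). Euler's condition for $F_1,F_2,F_3$ is the identity $xF_1+yF_2+zF_3=0$.
   Formalization: Euler's condition is taken up to an invertible C-linear change of basis of the span of F_1,F_2,F_3; the literal identity xF_1+yF_2+zF_3=0 fails for (F_2,F_1,F_3) when it holds for (F_1,F_2,F_3), though J and dim W = 3 are unchanged. *)

(* Defs.v *)
From HB Require Import structures.
From mathcomp Require Import all_boot all_order all_algebra reals complex mpoly.

Set Implicit Arguments.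
Unset Strict Implicit.
Unset Printing Implicit Defensive.

Import GRing.Theory.
Local Open Scope ring_scope.

(* The field is complex R = R[i] for a realType R (any model of the reals);
   the definitions below do not use more than the field structure. *)

(* C[x, y, z], with x = 'X_0, y = 'X_1, z = 'X_2. *)
Notation pol3 C := {mpoly C[3]}.

(* The vector space of forms of degree t, including 0. *)
Notation forms3 C t := (dhomog 3 C t).

Section Ideals.
Variable C : fieldType.
Implicit Types (I : pol3 C -> Prop) (F : 'rV[pol3 C]_3).

Definition ideal_gen F : pol3 C -> Prop :=
  fun p => exists a : 'I_3 -> pol3 C, p = \sum_i a i * F 0 i.

Definition is_ideal I : Prop :=
  [/\ I 0,
      forall p q, I p -> I q -> I (p + q)
    & forall a p, I p -> I (a * p)].

Definition homogeneous_ideal I : Prop :=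
  forall p, I p -> forall k, I (pihomog mdeg k p).

(* I = (I : m^oo), where m = <x, y, z>: the ideal m^k is generated by the
   monomials of degree k. *)
Definition saturated_ideal I : Prop :=
  forall p, (exists k, forall m : 'X_{1..3}, mdeg m = k -> I ('X_[m] * p)) ->
    I p.

(* k = dim_C (R / I)_t, for a homogeneous ideal I of R. *)
Definition hilbert_function I (t k : nat) : Prop :=
  exists V : {vspace forms3 C t},
    (forall v : forms3 C t, v \in V <-> I (val v))
    /\ (k + \dim V = \dim {:forms3 C t})%N.

Definition hilbert_polynomial I (P : {poly rat}) : Prop :=
  exists t0 : nat, forall t, (t0 <= t)%N ->
    exists k, hilbert_function I t k /\ P.[t%:R] = k%:R.

(* The dimension of a projective scheme is the degree of its Hilbert
   polynomial. *)
Definition zero_dimensional I : Prop :=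
  exists P, hilbert_polynomial I P /\ size P = 1%N.

(* I is (the saturated ideal of) a point of the Hilbert scheme H^N(P^2). *)
Definition hilbert_scheme_P2 (N : nat) I : Prop :=
  [/\ is_ideal I, homogeneous_ideal I, saturated_ideal I, zero_dimensional I
    & hilbert_polynomial I (N%:R)%:P].

Definition lin_independent F : Prop :=
  forall c : 'I_3 -> C, \sum_i c i *: F 0 i = 0 -> forall i, c i = 0.

Definition no_common_factor F : Prop :=
  forall g : pol3 C, (forall i, exists q, F 0 i = q * g) ->
    g \is a GRing.unit.

(* The complex
     0 -> R(-b1) (+) R(-b2) --phi2--> R(-d-1)^3 --phi1--> R --> R / I
   is a minimal graded free resolution of R / I. *)
Record min_graded_resolution (d : nat) (b1 b2 : nat) I
    (phi1 : 'rV[pol3 C]_3) (phi2 : 'M[pol3 C]_(3, 2)) : Prop := {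
  res_graded1 : forall i, phi1 0 i \is d.+1.-homog;
  res_graded2 : forall i,
    phi2 i 0 \is (b1 - d.+1).-homog /\ phi2 i 1 \is (b2 - d.+1).-homog;
  res_injective : forall v : 'cV[pol3 C]_2, phi2 *m v = 0 -> v = 0;
  res_exact_mid : forall u : 'cV[pol3 C]_3,
    phi1 *m u = 0 <-> exists v : 'cV[pol3 C]_2, u = phi2 *m v;
  (* the kernel of the quotient map R -> R / I is I *)
  res_exact_R : forall p,
    I p <-> exists u : 'cV[pol3 C]_3, p = (phi1 *m u) 0 0;
  (* minimality: all entries lie in the irrelevant ideal <x, y, z> *)
  res_minimal1 : forall i, (phi1 0 i)@_0%MM = 0;
  res_minimal2 : forall i j, (phi2 i j)@_0%MM = 0
}.

(* The entries of column j of phi2 belong to R_1, and W is their span. *)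
Definition column_span (phi2 : 'M[pol3 C]_(3, 2)) (j : 'I_2)
    (W : {vspace forms3 C 1}) : Prop :=
  exists L : 'I_3 -> forms3 C 1,
    (forall i, phi2 i j = val (L i)) /\ W = <<[seq L i | i : 'I_3]>>%VS.

Definition euler_identity F : Prop := \sum_(i < 3) 'X_i * F 0 i = 0.

(* Euler's condition is understood up to the choice of a C-basis of the span
   of F_1, F_2, F_3, i.e. of the degree d+1 part of the ideal. This is needed:
   a syzygy of F with linearly independent linear entries need not be
   (x, y, z), e.g. it is (y, x, z) for (F_2, F_1, F_3) when F satisfies the
   identity, and then (F_2, F_1, F_3) does not satisfy it. Passing to another
   basis is the same as a linear change of coordinates in the coefficients
   x, y, z of the identity. *)
Definition euler_condition F : Prop :=
  exists A : 'M[C]_3,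
    A \in unitmx /\ euler_identity (F *m map_mx (@mpolyC 3 C) A).

End Ideals.

(* Main.v *)
Require Import Defs.
From HB Require Import structures.
From mathcomp Require Import all_boot all_order all_algebra reals complex mpoly.
From mathcomp Require Import zify.

Set Implicit Arguments.
Unset Strict Implicit.
Unset Printing Implicit Defensive.

Import GRing.Theory.
Local Open Scope ring_scope.

(** Every linear syzygy of [F] is [phi2 *m v] for some [v], and comparing the
    components of degree 1 shows that only the columns of [phi2] with linear
    entries contribute to it, with constant coefficients.  The theorem follows
    once it is known that at most one column is linear, that is
    [b1 > d + 2].

    This is where the Hilbert polynomial enters.  Minimality and injectivity of
    [phi2] give [b2 >= d + 2] ([resolution_shift_gt]), so [b1 = d + 2] would
    force [b1 = b2 = d + 2].  Counting dimensions along the resolution in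
    degree [t], the codimension of the ideal would then be at least a quantity
    that grows like [(d - 1) t], whereas it is constant for large [t]; hence
    [d <= 1] ([hilbert_function_ge], [linear_presentation_degree]).

    So a linear column is the second one and forces [b2 = d + 2].  Conversely,
    if [b2 = d + 2], the entries of the second column form a nonzero linear
    syzygy, and if they spanned a line [<l>] then cancelling [l] would give a
    constant relation between [F_1, F_2, F_3]; so they span a space of
    dimension 2 or 3 ([linear_syzygy_dim]).

    For Euler's condition, writing linear forms in the coordinates [x, y, z]
    identifies an invertible matrix [A] such that [F *m A] satisfies Euler's
    identity with a linear syzygy of [F] whose entries are linearly independent
    ([euler_conditionP]).  Such a syzygy is a multiple of the second column
    ([linear_syzygy_column]), so it exists exactly when the second column is
    linear with independent entries ([euler_condition_column]). *)

(** * Homogeneous components of polynomials *)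

Lemma pihomogM (n : nat) (R : comNzRingType) (e k : nat) (p q : {mpoly R[n]}) :
  p \is e.-homog -> pihomog mdeg (e + k) (p * q) = p * pihomog mdeg k q.
Proof.
move=> hp; rewrite {1 2}[q]mpolyE mulr_sumr !raddf_sum mulr_sumr /=.
apply: eq_bigr => m _; rewrite -scalerAr !linearZ /= -scalerAr; congr (_ *: _).
have hpm : p * 'X_[m] \is (e + mdeg m).-homog by rewrite dhomogM ?dhomogX.
rewrite pihomogX; case: eqVneq => [<-|ne_mk]; first exact: pihomog_dE.
by rewrite mulr0; apply: pihomog_ne0 hpm; rewrite eqn_add2l.
Qed.

Lemma pihomogM_lt (n : nat) (R : comNzRingType) (e k : nat)
    (p q : {mpoly R[n]}) :
  p \is e.-homog -> (k < e)%N -> pihomog mdeg k (p * q) = 0.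
Proof.
move=> hp lt_ke; rewrite [q]mpolyE mulr_sumr raddf_sum big1 //= => m _.
rewrite -scalerAr linearZ /=.
have hpm : p * 'X_[m] \is (e + mdeg m).-homog by rewrite dhomogM ?dhomogX.
by rewrite (pihomog_ne0 _ hpm) ?scaler0 //; lia.
Qed.

Lemma dhomog0E (n : nat) (R : nzRingType) (p : {mpoly R[n]}) :
  p \is 0.-homog -> p = (p@_0%MM)%:MP.
Proof.
move=> hp; apply/mpolyP => m; rewrite mcoeffC; case: eqVneq => [->|m_neq0].
  by rewrite mulr1.
by rewrite mulr0 (dhomog_nemf_coeff hp) // mdeg_eq0.
Qed.

Lemma mcoeff_linear_form (n : nat) (R : nzRingType) (c : 'I_n -> R) (l : 'I_n) :
  (\sum_k c k *: 'X_k : {mpoly R[n]})@_U_(l) = c l.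
Proof.
rewrite raddf_sum (bigD1 l) //= mcoeffZ mcoeffXU eqxx mulr1 big1 ?addr0 //.
by move=> k ne_kl; rewrite mcoeffZ mcoeffXU (negbTE ne_kl) mulr0.
Qed.

Lemma dhomog1E (n : nat) (R : nzRingType) (p : {mpoly R[n]}) :
  p \is 1.-homog -> p = \sum_k p@_U_(k) *: 'X_k.
Proof.
move=> hp; apply/mpolyP => m.
have [/mdeg1P [k /eqP mE]|m_deg] := boolP (mdeg m == 1%N).
  by rewrite mE mcoeff_linear_form.
rewrite (dhomog_nemf_coeff hp) // raddf_sum big1 // => k _ /=.
rewrite mcoeffZ mcoeffX; case: eqP => [mE|]; last by rewrite mulr0.
by rewrite -mE mdeg1 eqxx in m_deg.
Qed.

Lemma pihomog0E (n : nat) (R : nzRingType) (p : {mpoly R[n]}) :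
  pihomog mdeg 0 p = (p@_0%MM)%:MP.
Proof.
rewrite [LHS]dhomog0E ?pihomogP //; congr _%:MP.
rewrite {2}[p]mpolyE pihomogE !raddf_sum big_mkcond /=; apply: eq_bigr => m _.
case: eqVneq => // m_deg; rewrite mcoeffZ mcoeffX.
by rewrite -mdeg_eq0 (negbTE m_deg) mulr0.
Qed.

(** * Linear forms and their coefficient matrices *)

Definition linear_coefs (C : fieldType) (L : 'I_3 -> forms3 C 1) : 'M[C]_3 :=
  \matrix_(i, k) (val (L i))@_U_(k).

Lemma linear_formE (C : fieldType) (L : 'I_3 -> forms3 C 1) i :
  val (L i) = \sum_k linear_coefs L i k *: 'X_k.
Proof.
rewrite [LHS]dhomog1E; first by apply: eq_bigr => k _; rewrite mxE.
exact: dhomog_is_dhomog.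
Qed.

(** The monomials [x, y, z] are a basis of the linear forms, so independence of
    three linear forms can be read off their coordinates. *)
Lemma dim_span_linear_forms (C : fieldType) (L : 'I_3 -> forms3 C 1) :
  \dim <<[seq L i | i : 'I_3]>> = 3%N <-> linear_coefs L \in unitmx.
Proof.
have -> : [seq L i | i : 'I_3] = [tuple L i | i < 3].
  by rewrite /image_mem -val_ord_tuple.
set X := mktuple _.
have -> : \dim <<X>> = 3%N <-> free X.
  by rewrite /free size_tuple; split=> [->|/eqP].
have XE (r : 'I_3 -> C) : \sum_i r i *: X`_i = \sum_i r i *: L i.
  by apply: eq_bigr => i _; rewrite -tnth_nth tnth_mktuple.
have combE (r : 'rV[C]_3) :
    val (\sum_i r 0 i *: L i) = \sum_k (r *m linear_coefs L) 0 k *: 'X_k.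
  rewrite raddf_sum /=.
  under eq_bigr => i _ do rewrite -/(val (L i)) linear_formE scaler_sumr.
  rewrite exchange_big; apply: eq_bigr => k _ /=.
  by rewrite mxE scaler_suml; apply: eq_bigr => i _; rewrite scalerA.
rewrite -row_free_unit; split=> [/freeP Xfree|Mfree].
  apply: inj_row_free => r rM0; apply/rowP => i; rewrite [RHS]mxE.
  apply: (Xfree (r 0)); rewrite XE; apply: val_inj; rewrite combE rM0.
  by rewrite big1 // => k _; rewrite mxE scale0r.
apply/freeP => r; rewrite XE => rL0 i.
have /(_ 1%N (\row_i r i) 0) := row_free_inj Mfree.
rewrite mul0mx => /(_ _)/rowP/(_ i); rewrite !mxE; apply.
have := combE (\row_i r i).
under eq_bigr => i0 _ do rewrite mxE.
rewrite rL0 /= => /esym sum0; apply/rowP => k; rewrite [RHS]mxE.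
by have := congr1 (mcoeff U_(k)) sum0; rewrite mcoeff0 mcoeff_linear_form.
Qed.

Lemma span_neq0 (K : fieldType) (vT : vectType K) (S : 'I_3 -> vT) :
  (0 < \dim <<[seq S i | i : 'I_3]>>)%N -> exists i, S i != 0.
Proof.
move=> dimS; apply/existsP; move: dimS; apply: contraTT.
rewrite negb_exists => /forallP S0.
suff -> : <<[seq S i | i : 'I_3]>>%VS = 0%VS by rewrite dimv0.
apply/eqP; rewrite -subv0; apply/span_subvP => _ /codomP[i ->].
by rewrite memv0; apply/negPn.
Qed.

(** Projecting makes multiplication by an arbitrary polynomial into a linear map
    between spaces of forms, without homogeneity assumptions. *)
Definition homog_part (n : nat) (C : fieldType) (t : nat) (p : {mpoly C[n]}) :
  dhomog n C t := DHomog (pihomogP mdeg t p).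

Lemma homog_part_is_linear (n : nat) (C : fieldType) (t : nat) :
  linear (@homog_part n C t).
Proof. by move=> c p q; apply: val_inj; rewrite /= linearP. Qed.

HB.instance Definition _ (n : nat) (C : fieldType) (t : nat) :=
  GRing.isLinear.Build C {mpoly C[n]} (dhomog n C t) _ (@homog_part n C t)
    (@homog_part_is_linear n C t).

Lemma linear_coefs_surj (C : fieldType) (A : 'M[C]_3) :
  exists L : 'I_3 -> forms3 C 1, linear_coefs L = A.
Proof.
exists (fun i => homog_part 1 (\sum_k A i k *: 'X_k)).
apply/matrixP => i l; rewrite mxE /= pihomog_dE ?mcoeff_linear_form //.
by apply: rpred_sum => k _; apply: rpredZ; rewrite dhomogX /= mdeg1.
Qed.

(** * Linear syzygies and Euler's condition *)

(** Both sides are the same double sum over the variables and the entries of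
    [F]: a change of basis of the span of [F] is a choice of three linear
    forms. *)
Lemma euler_identity_basis_change (C : fieldType) (F : 'rV[pol3 C]_3)
    (L : 'I_3 -> forms3 C 1) :
  euler_identity (F *m map_mx (@mpolyC 3 C) (linear_coefs L)) <->
  \sum_i val (L i) * F 0 i = 0.
Proof.
rewrite /euler_identity.
suff -> : \sum_(k < 3) 'X_k * (F *m map_mx (@mpolyC 3 C) (linear_coefs L)) 0 k
    = \sum_i val (L i) * F 0 i by [].
under eq_bigr => k _ do rewrite mxE mulr_sumr.
rewrite exchange_big; apply: eq_bigr => i _ /=.
rewrite -/(val (L i)) linear_formE mulr_suml; apply: eq_bigr => k _.
by rewrite !mxE mulrCA [RHS]mulrC -mul_mpolyC ['X_k * _]mulrC.
Qed.

(** This form of Euler's condition only mentions syzygies, so it can be compared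
    with the columns of a presentation. *)
Lemma euler_conditionP (C : fieldType) (F : 'rV[pol3 C]_3) :
  euler_condition F <->
  exists L : 'I_3 -> forms3 C 1,
    \dim <<[seq L i | i : 'I_3]>> = 3%N /\ \sum_i val (L i) * F 0 i = 0.
Proof.
split=> [[A [A_unit eulerF]]|[L [/dim_span_linear_forms L_unit syzL]]].
  have [L LA] := linear_coefs_surj A; exists L.
  by rewrite dim_span_linear_forms -euler_identity_basis_change LA.
by exists (linear_coefs L); split; rewrite ?euler_identity_basis_change.
Qed.

(** If the entries spanned a line, they would be constant multiples [c_i l] of one
    form [l]; as the polynomial ring is a domain, [l] cancels and the [c_i] are
    a linear relation between the entries of [F]. *)
Lemma linear_syzygy_dim (C : fieldType) (F : 'rV[pol3 C]_3)
    (L : 'I_3 -> forms3 C 1) (i0 : 'I_3) :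
  lin_independent F -> \sum_i val (L i) * F 0 i = 0 -> L i0 != 0 ->
  \dim <<[seq L i | i : 'I_3]>> = 2%N \/ \dim <<[seq L i | i : 'I_3]>> = 3%N.
Proof.
move=> Findep syzL L_neq0.
suff dim_ge2 : (2 <= \dim <<[seq L i | i : 'I_3]>>)%N.
  have dim_le3 : (\dim <<[seq L i | i : 'I_3]>> <= 3)%N.
    by apply: leq_trans (dim_span _) _; rewrite size_map size_enum_ord.
  lia.
rewrite ltnNge; apply/negP => dimW.
have L_in i : L i \in <<[seq L i | i : 'I_3]>>%VS.
  by rewrite memv_span // map_f ?mem_enum.
have WE : (<[L i0]> = <<[seq L i | i : 'I_3]>>)%VS.
  by apply/eqP; rewrite eqEdim -memvE L_in dim_vline L_neq0.
have [c cE] : exists c : 'I_3 -> C, forall i, L i = c i *: L i0.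
  have /fin_all_exists[c cE] i : exists c, L i = c *: L i0.
    by apply/vlineP; rewrite WE.
  by exists c.
have c0 : forall i, c i = 0.
  apply: Findep; apply: (mulfI (x := val (L i0))).
    by apply: contraNneq L_neq0 => L0; apply/eqP/val_inj.
  rewrite mulr0 mulr_sumr -[RHS]syzL; apply: eq_bigr => i _.
  by rewrite (cE i) -scalerAr scalerAl.
by rewrite (cE i0) c0 scale0r eqxx in L_neq0.
Qed.

(** * Dimension counts in a fixed degree *)

Lemma double_bin2 (n : nat) : (2 * 'C(n + 2, 2) = (n + 2) * (n + 1))%N.
Proof. by rewrite -mul_bin_diag bin1 !addnS addn0. Qed.

Lemma dim_forms3 (C : fieldType) (t : nat) :
  \dim {:forms3 C t} = 'C(t + 2, 2).
Proof. by rewrite dimvf -[RHS]bin_sub ?addnK // leq_addl. Qed.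

(** The maps of a resolution in one degree: [relation_map] is the product with the
    row [F], and [syzygy_map] the product with [phi2]. *)
Definition relation_map (C : fieldType) (F : 'rV[pol3 C]_3) (s t : nat)
  (u : {ffun 'I_3 -> forms3 C s}) : forms3 C t :=
  homog_part t (\sum_i F 0 i * val (u i)).

Lemma relation_map_is_linear (C : fieldType) (F : 'rV[pol3 C]_3) (s t : nat) :
  linear (@relation_map C F s t).
Proof.
move=> c u v; rewrite /relation_map -linearP; congr homog_part.
rewrite scaler_sumr -big_split; apply: eq_bigr => i _ /=.
by rewrite !ffunE /= mulrDr scalerAr.
Qed.

HB.instance Definition _ (C : fieldType) (F : 'rV[pol3 C]_3) (s t : nat) :=
  GRing.isLinear.Build C {ffun 'I_3 -> forms3 C s} (forms3 C t) _
    (@relation_map C F s t) (@relation_map_is_linear C F s t).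

Definition syzygy_map (C : fieldType) (phi2 : 'M[pol3 C]_(3, 2))
    (s0 s1 s : nat) (v : forms3 C s0 * forms3 C s1) :
  {ffun 'I_3 -> forms3 C s} :=
  [ffun i => homog_part s (phi2 i 0 * val v.1 + phi2 i 1 * val v.2)].

Lemma syzygy_map_is_linear (C : fieldType) (phi2 : 'M[pol3 C]_(3, 2))
    (s0 s1 s : nat) :
  linear (@syzygy_map C phi2 s0 s1 s).
Proof.
move=> c v w; apply/ffunP => i; rewrite !ffunE -linearP; congr homog_part.
by rewrite /= !mulrDr scalerDr !scalerAr addrACA.
Qed.

HB.instance Definition _ (C : fieldType) (phi2 : 'M[pol3 C]_(3, 2))
    (s0 s1 s : nat) :=
  GRing.isLinear.Build C (forms3 C s0 * forms3 C s1)%type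
    {ffun 'I_3 -> forms3 C s} _
    (@syzygy_map C phi2 s0 s1 s) (@syzygy_map_is_linear C phi2 s0 s1 s).

(** In degree [t] the ideal lies in the image of [relation_map], whose kernel
    contains the image of the injective [syzygy_map]; the rank theorem bounds
    the dimension of the ideal from above.  The degree shifts are the
    hypotheses on [t] and [s], so that no truncated subtraction occurs. *)
Lemma hilbert_function_ge (C : fieldType) (F : 'rV[pol3 C]_3)
    (phi2 : 'M[pol3 C]_(3, 2)) (e e0 e1 s0 s1 s t k : nat) :
  (forall i, F 0 i \is e.-homog) ->
  (forall i, phi2 i 0 \is e0.-homog /\ phi2 i 1 \is e1.-homog) ->
  F *m phi2 = 0 -> (forall v : 'cV[pol3 C]_2, phi2 *m v = 0 -> v = 0) ->
  t = (e + s)%N -> s = (e0 + s0)%N -> s = (e1 + s1)%N ->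
  hilbert_function (ideal_gen F) t k ->
  ('C(t + 2, 2) + 'C(s0 + 2, 2) + 'C(s1 + 2, 2) <= k + 3 * 'C(s + 2, 2))%N.
Proof.
move=> Fhom phi2hom Fphi2 phi2inj tE sE0 sE1 [V [VP dimV]].
pose f1 := linfun (@relation_map C F s t).
pose f2 := linfun (@syzygy_map C phi2 s0 s1 s).
have V_sub : (V <= limg f1)%VS.
  apply/subvP => p /VP[a pE]; apply/memv_imgP.
  exists [ffun i => homog_part s (a i)]; rewrite ?memvf // lfunE.
  apply: val_inj => /=; rewrite -[LHS](pihomog_dE (dhomog_is_dhomog p)) pE.
  rewrite !raddf_sum; apply: eq_bigr => i _ /=.
  by rewrite ffunE mulrC tE !pihomogM //= pihomog_id.
have f2E v i : val (f2 v i) = phi2 i 0 * val v.1 + phi2 i 1 * val v.2.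
  have [hom0 hom1] := phi2hom i.
  rewrite lfunE ffunE /= raddfD /= {1}sE0 {1}sE1 !pihomogM //.
  by rewrite !pihomog_dE //; apply: dhomog_is_dhomog.
have ker2 : lker f2 = 0%VS.
  apply/eqP; rewrite -subv0; apply/subvP => v; rewrite memv_ker => /eqP f2v0.
  pose w : 'cV[pol3 C]_2 := \col_j (if j == 0 then val v.1 else val v.2).
  have /colP w0 : w = 0.
    apply: phi2inj; apply/colP => i; rewrite !mxE big_ord_recl big_ord1 !mxE /=.
    have := f2E v i; rewrite f2v0 ffunE /= => /esym.
    by congr (_ + phi2 i _ * _ = _); apply: val_inj.
  rewrite memv0; apply/eqP; case: v @w {f2v0} w0 => v1 v2 w w0.
  have := w0 0; have := w0 1; rewrite !mxE /= => v20 v10.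
  by congr (_, _); apply: val_inj.
have im2_sub : (limg f2 <= lker f1)%VS.
  apply/subvP => _ /memv_imgP[v _ ->]; rewrite memv_ker lfunE; apply/eqP.
  apply: val_inj => /=.
  under eq_bigr => i _ do rewrite -/(val (f2 v i)) f2E mulrDr !mulrA.
  rewrite big_split /= -!mulr_suml.
  have F0 j : \sum_i F 0 i * phi2 i j = 0.
    by have /matrixP/(_ 0 j) := Fphi2; rewrite !mxE.
  by rewrite !F0 !mul0r addr0 pihomog0.
have := limg_ker_dim f1 fullv; have := limg_ker_dim f2 fullv.
have := dimvS V_sub; have := dimvS im2_sub.
rewrite !capfv ker2 dimv0 add0n.
have dim_forms u : dim (forms3 C u) = 'C(u + 2, 2).
  by rewrite -dimvf dim_forms3.
have -> : \dim {:{ffun 'I_3 -> forms3 C s}} = (3 * 'C(s + 2, 2))%N.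
  by rewrite dimvf -dim_forms -[in RHS](card_ord 3).
have -> : \dim {:(forms3 C s0 * forms3 C s1)%type}
    = ('C(s0 + 2, 2) + 'C(s1 + 2, 2))%N.
  by rewrite dimvf -!dim_forms.
move=> dim_im2 dimV_le dim2 dim1; rewrite dim_forms3 in dimV.
rewrite -dimV -addnA -dim2 -dim1 -addnA leq_add2l addnC.
exact: leq_add.
Qed.

(** * Columns of a minimal resolution *)

Lemma resolution_complex (C : fieldType) (d b1 b2 : nat) (I : pol3 C -> Prop)
    (F : 'rV[pol3 C]_3) (phi2 : 'M[pol3 C]_(3, 2)) :
  min_graded_resolution d b1 b2 I F phi2 -> F *m phi2 = 0.
Proof.
move=> res; apply/matrixP => i j; rewrite [RHS]mxE.
have : F *m (phi2 *m delta_mx j 0) = 0 :> 'cV__.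
  by apply/(res_exact_mid res); exists (delta_mx j 0).
by rewrite mulmxA -colE => /matrixP/(_ i 0); rewrite !mxE.
Qed.

Lemma resolution_column_syzygy (C : fieldType) (d b1 b2 : nat)
    (I : pol3 C -> Prop) (F : 'rV[pol3 C]_3) (phi2 : 'M[pol3 C]_(3, 2)) j :
  min_graded_resolution d b1 b2 I F phi2 -> \sum_i phi2 i j * F 0 i = 0.
Proof.
move=> /resolution_complex/matrixP/(_ 0 j); rewrite !mxE => syz.
by rewrite -[RHS]syz; apply: eq_bigr => i _; rewrite mulrC.
Qed.

Lemma resolution_column_neq0 (C : fieldType) (d b1 b2 : nat)
    (I : pol3 C -> Prop) (F : 'rV[pol3 C]_3) (phi2 : 'M[pol3 C]_(3, 2)) j :
  min_graded_resolution d b1 b2 I F phi2 -> exists i, phi2 i j != 0.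
Proof.
move=> res; apply/existsP; apply: contraT; rewrite negb_exists => /forallP col0.
have /(res_injective res)/matrixP/(_ j 0) : phi2 *m delta_mx j 0 = 0 :> 'cV__.
  by rewrite -colE; apply/colP => i; rewrite !mxE; apply/eqP/negPn/col0.
by rewrite !mxE !eqxx => /eqP; rewrite oner_eq0.
Qed.

(** For [b2 <= d + 1] the second column would consist of constants; these vanish
    by minimality, against the injectivity of [phi2]. *)
Lemma resolution_shift_gt (C : fieldType) (d b1 b2 : nat)
    (I : pol3 C -> Prop) (F : 'rV[pol3 C]_3) (phi2 : 'M[pol3 C]_(3, 2)) :
  min_graded_resolution d b1 b2 I F phi2 -> (d.+1 < b2)%N.
Proof.
move=> res; rewrite ltnNge; apply/negP => b2_le.
have [i /eqP[]] := resolution_column_neq0 1 res.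
have [_] := res_graded2 res i.
by rewrite (eqP b2_le) => /dhomog0E ->; rewrite (res_minimal2 res).
Qed.

Lemma ord2P (j : 'I_2) : j = 0 \/ j = 1.
Proof. by case: j => -[|[|//]] ?; [left|right]; apply: val_inj. Qed.

Lemma linear_column_shift (C : fieldType) (d b1 b2 : nat)
    (I : pol3 C -> Prop) (F : 'rV[pol3 C]_3) (phi2 : 'M[pol3 C]_(3, 2))
    (j : 'I_2) (W : {vspace forms3 C 1}) :
  min_graded_resolution d b1 b2 I F phi2 -> column_span phi2 j W ->
  (if j == 0 then b1 else b2) = d.+2.
Proof.
move=> res [L [LE _]].
have [i phi_neq0] := resolution_column_neq0 j res.
have [hom0 hom1] := res_graded2 res i.
have hom : phi2 i j \is ((if j == 0 then b1 else b2) - d.+1).-homog.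
  case: eqVneq => [->|]; first exact: hom0.
  by case: (ord2P j) => ->.
have hom_1 : phi2 i j \is 1.-homog by rewrite LE; apply: dhomog_is_dhomog.
by have := dhomog_uniq phi_neq0 hom hom_1; lia.
Qed.

(** Twice the lower bound of [hilbert_function_ge] for [b1 = b2 = d + 2] has
    leading term [2 (d - 1) t], so the Hilbert function is unbounded for
    [d >= 2]. *)
Lemma linear_presentation_degree (C : fieldType) (d N : nat)
    (F : 'rV[pol3 C]_3) (phi2 : 'M[pol3 C]_(3, 2)) :
  min_graded_resolution d d.+2 d.+2 (ideal_gen F) F phi2 ->
  hilbert_polynomial (ideal_gen F) (N%:R)%:P -> (d <= 1)%N.
Proof.
move=> res [t0 hilbN].
(* For d >= 2 the bound reads 2 N >= 2 s + 16 at least, which fails as soon as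
   N <= s. *)
pose s := (t0 + N)%N.
have t0_le : (t0 <= d.+1 + (1 + s))%N by rewrite /s; lia.
have [k [Ik /eqP]] := hilbN _ t0_le.
rewrite hornerC Num.Theory.eqr_nat => /eqP kE; rewrite -{k}kE in Ik.
have hom2 i : phi2 i 0 \is 1.-homog /\ phi2 i 1 \is 1.-homog.
  by have := res_graded2 res i; rewrite subSnn.
have := hilbert_function_ge (res_graded1 res) hom2 (resolution_complex res)
  (res_injective res) (erefl _) (erefl (1 + s)%N) (erefl (1 + s)%N) Ik.
have := double_bin2 (d.+1 + (1 + s)); have := double_bin2 s.
have := double_bin2 (1 + s).
have : (N <= s)%N by rewrite leq_addl.
move=> le_Ns dim_s1 dim_s dim_t dim_le; rewrite leqNgt; apply/negP => d_ge2.
have : ((s + 6) * (s + 5) <= (d.+1 + (1 + s) + 2) * (d.+1 + (1 + s) + 1))%N.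
  by apply: leq_mul; lia.
nia.
Qed.

(** Exactness writes the syzygy as [phi2 *m v].  In degree 1 the first column, of
    degree at least 2, contributes nothing, and the second one contributes only
    if it is linear, with the constant term of its coefficient. *)
Lemma linear_syzygy_column (C : fieldType) (d b1 b2 : nat)
    (I : pol3 C -> Prop) (F : 'rV[pol3 C]_3) (phi2 : 'M[pol3 C]_(3, 2))
    (L : 'I_3 -> forms3 C 1) (i0 : 'I_3) :
  min_graded_resolution d b1 b2 I F phi2 -> (d.+2 < b1)%N ->
  \sum_i val (L i) * F 0 i = 0 -> L i0 != 0 ->
  b2 = d.+2 /\ exists c, forall i, val (L i) = c *: phi2 i 1.
Proof.
move=> res b1_gt syzL L_neq0.
have [v vE] : exists v : 'cV[pol3 C]_2, \col_i val (L i) = phi2 *m v.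
  apply/(res_exact_mid res)/matrixP => i j; rewrite (ord1 i) (ord1 j) !mxE.
  by rewrite -[RHS]syzL; apply: eq_bigr => k _; rewrite mxE mulrC.
have LE i : val (L i) = pihomog mdeg 1 (phi2 i 1 * v 1 0).
  have [hom0 _] := res_graded2 res i.
  have /colP/(_ i) := vE; rewrite !mxE big_ord_recl big_ord1 => syzE.
  rewrite -[LHS](pihomog_dE (dhomog_is_dhomog (L i))) syzE.
  rewrite raddfD /= (pihomogM_lt _ hom0) ?add0r; last by lia.
  by congr (pihomog _ _ (phi2 i _ * v _ _)); apply: val_inj.
have b2_gt := resolution_shift_gt res.
have b2E : b2 = d.+2.
  apply/eqP; apply: contraNT L_neq0 => b2_neq; apply/eqP/val_inj.
  have [_ hom1] := res_graded2 res i0.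
  by rewrite LE (pihomogM_lt _ hom1) //; lia.
split=> //; exists ((v 1 0)@_0%MM) => i.
have [_] := res_graded2 res i; rewrite {1}b2E subSnn => hom1.
by rewrite LE (pihomogM 0 _ hom1) pihomog0E mulrC mul_mpolyC.
Qed.

(** A syzygy with independent linear entries is a scalar multiple of the second
    column, so its coefficient matrix is invertible only if that of the column
    is. *)
Lemma euler_condition_column (C : fieldType) (d b1 b2 : nat)
    (I : pol3 C -> Prop) (F : 'rV[pol3 C]_3) (phi2 : 'M[pol3 C]_(3, 2))
    (W : {vspace forms3 C 1}) :
  min_graded_resolution d b1 b2 I F phi2 -> (d.+2 < b1)%N ->
  column_span phi2 1 W -> (euler_condition F <-> \dim W = 3%N).
Proof.
move=> res b1_gt [L [LE ->]]; rewrite euler_conditionP.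
split=> [[S [dimS syzS]]|dimL]; last first.
  exists L; split=> //; rewrite -[RHS](resolution_column_syzygy 1 res).
  by apply: eq_bigr => i _; rewrite LE.
have [|i S_neq0] := @span_neq0 _ _ S; first by rewrite dimS.
have [_ [c SE]] := linear_syzygy_column res b1_gt syzS S_neq0.
apply/dim_span_linear_forms; move/dim_span_linear_forms: dimS.
have -> : linear_coefs S = c *: linear_coefs L.
  by apply/matrixP => k l; rewrite !mxE (SE k) LE mcoeffZ.
by rewrite !unitmxE detZ unitrM => /andP[].
Qed.

Theorem theorem3p3 (K : realType) (d : nat)
    (F : 'rV[{mpoly K[i][3]}]_3)
    (b1 b2 : nat) (phi2 : 'M[{mpoly K[i][3]}]_(3, 2)) :
  (2 <= d)%N ->
  (forall i, F 0 i \is d.+1.-homog) ->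
  lin_independent F ->
  no_common_factor F ->
  hilbert_scheme_P2 (d ^ 2 + d + 1)%N (ideal_gen F) ->
  (forall p, ideal_gen F p -> (msize p <= d.+1)%N -> p = 0) ->
  min_graded_resolution d b1 b2 (ideal_gen F) F phi2 ->
  (b2 <= b1)%N ->
  (d.+1 <= b2)%N ->
  [/\ (exists (j : 'I_2) (W : {vspace dhomog 3 K[i] 1}),
         column_span phi2 j W /\ (\dim W = 2%N \/ \dim W = 3%N))
        <-> b2 = d.+2,
      forall (j : 'I_2) (W : {vspace dhomog 3 K[i] 1}),
        column_span phi2 j W -> \dim W = 2%N \/ \dim W = 3%N ->
        (euler_condition F <-> \dim W = 3%N)
    & euler_condition F <->
        exists (j : 'I_2) (W : {vspace dhomog 3 K[i] 1}),
          column_span phi2 j W /\ \dim W = 3%N].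
Proof.
move=> d_ge2 _ Findep _ [_ _ _ _ hilbN] _ res b2_le_b1 _.
have b2_ge := resolution_shift_gt res.
(* Otherwise both columns are linear, which the Hilbert polynomial excludes. *)
have b1_gt : (d.+2 < b1)%N.
  rewrite ltnNge; apply/negP => b1_le.
  have b1E : b1 = d.+2 by lia.
  have b2E : b2 = d.+2 by lia.
  move: res; rewrite b1E b2E => /linear_presentation_degree/(_ hilbN); lia.
have column1 j W : column_span phi2 j W -> j = 1 /\ b2 = d.+2.
  move=> /(linear_column_shift res).
  by case: (ord2P j) => -> //= b1E; rewrite b1E ltnn in b1_gt.
have column1_span : b2 = d.+2 -> exists W : {vspace dhomog 3 K[i] 1},
    column_span phi2 1 W /\ (\dim W = 2%N \/ \dim W = 3%N).
  move=> b2E.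
  have hom1 i : phi2 i 1 \is 1.-homog.
    by have [_] := res_graded2 res i; rewrite b2E subSnn.
  pose L i := DHomog (hom1 i).
  exists <<[seq L i | i : 'I_3]>>%VS; split; first by exists L.
  have [i0 phi_neq0] := resolution_column_neq0 1 res.
  have L_neq0 : L i0 != 0 by apply: contraNneq phi_neq0 => /(congr1 val) /= ->.
  have syzL : \sum_i val (L i) * F 0 i = 0 := resolution_column_syzygy 1 res.
  exact: linear_syzygy_dim Findep syzL L_neq0.
have eulerP j W : column_span phi2 j W ->
    (euler_condition F <-> \dim W = 3%N).
  move=> phiW; have [jE _] := column1 _ _ phiW; rewrite jE in phiW.
  exact: euler_condition_column res b1_gt phiW.
split.
- split=> [[j [W [/column1[]]]] //|/column1_span[W WP]].
  by exists 1, W.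
- by move=> j W phiW _; exact: eulerP phiW.
- split=> [eulerF|[j [W [phiW dimW]]]]; last exact/(eulerP j W phiW).
  have b2E : b2 = d.+2.
    have [S [dimS syzS]] := (euler_conditionP F).1 eulerF.
    have [|i S_neq0] := @span_neq0 _ _ S; first by rewrite dimS.
    by have [] := linear_syzygy_column res b1_gt syzS S_neq0.
  have [W [phiW _]] := column1_span b2E.
  by exists 1, W; split=> //; apply/(eulerP 1 W phiW).
Qed.
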